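(* (1) Assume that $\operatorname{cov}(\mathcal{N})=\operatorname{cof}(\mathcal{N})=\mathfrak{b}$. Then for every $\mathfrak{b}$-Sierpiński set $S$ there is a $\mathfrak{b}$-Sierpiński set $S'$ such that the product space $S\times S'$ does not satisfy $\mathsf{S}_1(\Gamma,\Gamma)$. (2) Assume that $\operatorname{cov}(\mathcal{N})=\operatorname{cof}(\mathcal{N})=\mathfrak{d}=\mathfrak{c}$ and the cardinal number $\mathfrak{c}$ is regular. Then for every $\mathfrak{c}$-Sierpiński set $S$ there is a $\mathfrak{c}$-Sierpiński set $S'$ such that the product space $S\times S'$ does not satisfy $\mathsf{S}_1(\Gamma,\mathrm{O})$.
   Context: $P(\mathbb{N})$ is the power set of $\mathbb{N}$, identified via characteristic functions with the Cantor cube $\{0,1\}^{\mathbb{N}}$, with the corresponding topology and the standard product (fair-coin) measure; ''null'' refers to this measure. $\operatorname{cov}(\mathcal{N})$ is the minimal cardinality of a family of null subsets of $P(\mathbb{N})$ whose union is $P(\mathbb{N})$; $\operatorname{cof}(\mathcal{N})$ is the minimal cardinality of a family of null subsets of $P(\mathbb{N})$ such that every null subset of $P(\mathbb{N})$ is contained in a member of the family. $\mathfrak{b}$ and $\mathfrak{d}$ are the usual bounding and dominating numbers (of $\mathbb{N}^{\mathbb{N}}$ under eventual domination $\le^*$), and $\mathfrak{c}$ is the cardinality of the continuum. For an uncountable $\kappa$, a set $X\subseteq P(\mathbb{N})$ is a $\kappa$-Sierpiński set if $|X|\ge\kappa$ and $|X\cap Y|<\kappa$ for every null set $Y\subseteq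 P(\mathbb{N})$. Such sets are considered with the subspace topology. A cover of a space is a family of proper subsets of the space whose union is the whole space; it is open if its members are open. $\mathrm{O}$ is the class of all open covers. A cover is a $\gamma$-cover if it is infinite and each point of the space belongs to all but finitely many members of the cover; $\Gamma$ is the class of all open $\gamma$-covers. For classes $\mathcal{A},\mathcal{B}$ of covers, let $\mathcal{A}(X)$, $\mathcal{B}(X)$ denote the covers of $X$ in the class; a space $X$ satisfies $\mathsf{S}_1(\mathcal{A},\mathcal{B})$ if for each sequence $\mathcal{U}_1,\mathcal{U}_2,\dots\in\mathcal{A}(X)$ there are sets $U_1\in\mathcal{U}_1,U_2\in\mathcal{U}_2,\dots$ such that $\{U_n:n\in\mathbb{N}\}\in\mathcal{B}(X)$. *)

(* Defs.v *)
From HB Require Import structures.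
From mathcomp Require Import all_boot all_order all_algebra finmap.
From mathcomp Require Import all_classical all_reals.
From mathcomp Require Import topology normedtype sequences numfun cantor.
From mathcomp Require Import measure.

Set Implicit Arguments.
Unset Strict Implicit.
Unset Printing Implicit Defensive.

Import Order.TTheory GRing.Theory Num.Theory.
Import numFieldNormedType.Exports.

Local Open Scope classical_set_scope.
Local Open Scope ring_scope.

(* P(N) is represented by [cantor_space] = nat -> bool with the product
   topology. *)

(* The sigma-algebra generated by the finitary sets is the product (= Borel)
   one; [fair_coin] below is the Caratheodory extension to it. *)
Definition depends_on (n : nat) (A : set cantor_space) :=
  forall x y : cantor_space, (forall i, (i < n)%N -> x i = y i) -> A x -> A y.

Definition finitary : set (set cantor_space) :=
  [set A | exists n, depends_on n A].

Lemma depends_on_le n m A : (n <= m)%N -> depends_on n A -> depends_on m A.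
Proof. by move=> nm An x y xy; apply: An => i /leq_trans /(_ nm); exact: xy. Qed.

Lemma finitary0 : finitary set0.
Proof. by exists 0%N. Qed.

Lemma finitaryU : setU_closed finitary.
Proof.
move=> A B [n An] [m Bm]; exists (maxn n m) => x y xy [Ax|Bx]; [left|right].
- by apply: (depends_on_le (leq_maxl n m) An) Ax.
- by apply: (depends_on_le (leq_maxr n m) Bm) Bx.
Qed.

Lemma finitaryC : setC_closed finitary.
Proof.
move=> A [n An]; exists n => x y xy nAx Ay; apply: nAx.
by apply: An Ay => i ni; rewrite xy.
Qed.

Definition coin_type : Type := cantor_space.
Definition coin_display : measure_display. Proof. exact. Qed.

HB.instance Definition _ := Pointed.on coin_type.
HB.instance Definition _ :=
  @isAlgebraOfSets.Build coin_display coin_type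
    finitary finitary0 finitaryU finitaryC.

Definition pad (t : seq bool) : cantor_space := fun i => nth false t i.

Section fair_coin.
Variable R : realType.

(* Proportion of the words of length n whose extension by zeros is in A. *)
Definition word_freq (A : set cantor_space) (n : nat) : R :=
  (\sum_(t : n.-tuple bool) \1_A (pad t)) / 2 ^+ n.

(* For A depending on the first m coordinates, [word_freq A n] is constant from
   n = m on. *)
Definition coin_content (A : set coin_type) : \bar R :=
  (limn (word_freq A))%:E.

Lemma word_freqS n A : depends_on n A -> word_freq A n.+1 = word_freq A n.
Proof.
move=> An; rewrite /word_freq exprS invfM mulrA; congr (_ / _).
pose f (p : n.-tuple bool * bool) : n.+1.-tuple bool := [tuple of rcons p.1 p.2].
have finj : injective f.
  move=> [s b] [t c] /(congr1 val) /= /eqP; rewrite eqseq_rcons.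
  by move=> /andP[/eqP/val_inj -> /eqP ->].
have fbij : bijective f.
  by apply: inj_card_bij => //; rewrite card_prod !card_tuple card_bool expnSr.
rewrite (reindex f) /=; last exact: onW_bij.
have E (p : n.-tuple bool * bool) : p \in predT ->
    \1_A (pad (f p)) = \1_A (pad p.1) :> R.
  move=> _; rewrite !indicE; congr (nat_of_bool _)%:R.
  have xy i : (i < n)%N -> pad (f p) i = pad p.1 i.
    by move=> ni; rewrite /pad /f /= nth_rcons size_tuple ni.
  apply/idP/idP => /set_mem H; apply/mem_set; move: H; apply: An => i /xy //.
rewrite (eq_bigr _ E).
rewrite -(pair_bigA _ (fun (t : n.-tuple bool) (b : bool) => \1_A (pad t) : R)) /=.
under eq_bigr do rewrite sumr_const card_bool.
by rewrite sumrMnl -(mulr_natr (\sum_t _)) mulfK // pnatr_eq0.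
Qed.

Lemma word_freq_ge n m A :
  depends_on n A -> (n <= m)%N -> word_freq A m = word_freq A n.
Proof.
move=> An /subnK <-; elim: (m - n)%N => [//|k IH]; rewrite addSn.
by rewrite word_freqS //; apply: depends_on_le An; rewrite leq_addl.
Qed.

Lemma coin_contentE n A : depends_on n A -> coin_content A = (word_freq A n)%:E.
Proof.
move=> An; congr EFin; apply: lim_near_cst => //.
by near=> m; apply: word_freq_ge => //; near: m; exact: nbhs_infty_ge.
Unshelve. all: by end_near. Qed.

Lemma word_freq_ge0 A n : 0 <= word_freq A n.
Proof.
by rewrite /word_freq divr_ge0 ?exprn_ge0 ?ler0n// sumr_ge0.
Qed.

Lemma coin_content_ge0 A : (0 <= coin_content A)%E.
Proof.
rewrite lee_fin; have [cv|/dvgP ->//] := pselect (cvgn (word_freq A)).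
by apply: limr_ge => //; apply: nearW => n; exact: word_freq_ge0.
Qed.

Lemma coin_content0 : coin_content set0 = 0%E.
Proof.
rewrite (@coin_contentE 0) // /word_freq big1 ?mul0r // => t _.
by rewrite indic0.
Qed.

Lemma coin_content_semi_additive : measure_function.semi_additive coin_content.
Proof.
apply/(additive2P coin_content0) => A B [n An] [m Bm] AB.
have An' := depends_on_le (leq_maxl n m) An.
have Bm' := depends_on_le (leq_maxr n m) Bm.
have ABm : depends_on (maxn n m) (A `|` B).
  by move=> x y xy [/(An' _ _ xy)|/(Bm' _ _ xy)]; [left|right].
rewrite (coin_contentE An') (coin_contentE Bm') (coin_contentE ABm) -EFinD.
congr EFin; rewrite /word_freq -mulrDl -big_split /=; congr (_ / _).
apply: eq_bigr => t _; rewrite !indicE in_setU.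
have [tA|] := boolP (pad t \in A); have [tB|] := boolP (pad t \in B);
  rewrite ?addr0 ?add0r //.
by have : (A `&` B) (pad t); [split; exact: set_mem|rewrite AB].
Qed.

HB.instance Definition _ := isContent.Build _ _ R coin_content
  coin_content_ge0 coin_content_semi_additive.

Lemma finitary_open A : finitary A -> open A.
Proof.
move=> [n An]; rewrite openE => x Ax; rewrite /interior.
have : \forall y \near x, forall i, (i < n)%N -> x i = y i.
  elim: n {An} => [|n IH]; first exact: (@filterE _ (nbhs x)).
  have xn : \forall y \near x, (y : cantor_space) n = x n.
    have := @proj_continuous nat (fun=> bool) n x [set x n].
    by apply; exact: discrete_set1.
  apply: filterS2 IH xn => y yn xyn i.
  by rewrite ltnS leq_eqVlt => /predU1P[->|/yn].
by apply: filterS => y xy; exact: An Ax.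
Qed.

Lemma coin_content_sigma_subadditive :
  measurable_subset_sigma_subadditive coin_content.
Proof.
move=> A F mF mA AF.
have : compact (A : set cantor_space).
  apply: (subclosed_compact _ cantor_space_compact) => //.
  by rewrite -openC; apply: finitary_open; exact: finitaryC.
rewrite compact_cover => /(_ nat setT F) [i _|//|D _ AD].
  exact/finitary_open/mF.
pose n := (\max_(i <- enum_fset D) i).+1.
apply: (@le_trans _ _ (\sum_(i < n) coin_content (F i))%E).
  apply: content_subadditive => // x /AD[i /= iD Fx].
  rewrite -bigcup_mkord; exists i => //=.
  by rewrite ltnS; exact: (@leq_bigmax_seq _ _ xpredT id i iD).
rewrite -(big_mkord xpredT (coin_content \o F)).
by apply: nneseries_lim_ge => k _ _; exact: coin_content_ge0.
Qed.

HB.instance Definition _ := Content_SigmaSubAdditive_isMeasure.Build _ _ _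
  coin_content coin_content_sigma_subadditive.

Definition fair_coin := measure_extension coin_content.

HB.instance Definition _ := Measure.on fair_coin.

Lemma fair_coin_cylinder (t : seq bool) :
  fair_coin [set x | forall i, (i < size t)%N -> x i = nth false t i]
  = (2 ^- size t)%:E.
Proof.
set A := [set _ | _].
have dA : depends_on (size t) A.
  by move=> x y xy Ax i it; rewrite -xy // Ax.
have -> : fair_coin A = coin_content A.
  by apply: measurable_mu_extE; exists (size t).
rewrite (coin_contentE dA); congr EFin.
rewrite /word_freq (bigD1 (in_tuple t)) //= big1 ?addr0; last first.
  move=> s st; rewrite indicE memNset // => As; move/eqP: st; apply.
  apply/val_inj/(@eq_from_nth _ false) => [|i]; rewrite /= size_tuple// => it.
  exact: As.
by rewrite indicE mem_set ?mul1r.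
Qed.

Definition coin_null : set (set cantor_space) :=
  [set Y | fair_coin.-negligible Y].

End fair_coin.

Definition card_lt T U (A : set T) (B : set U) : bool :=
  (A #<= B)%card && ~~ (B #<= A)%card.

(* A cardinal number is represented by any set K of that cardinality: here |K| is
   the minimum of the |F| for F in P. *)
Definition is_min_card T U (P : set (set T)) (K : set U) : Prop :=
  (exists2 F, P F & (F #= K)%card) /\ (forall F, P F -> (K #<= F)%card).

Definition null_covering (R : realType) : set (set (set cantor_space)) :=
  [set F | F `<=` coin_null R /\ \bigcup_(Y in F) Y = setT].

Definition null_cofinal (R : realType) : set (set (set cantor_space)) :=
  [set F | F `<=` coin_null R /\
    forall Y, coin_null R Y -> exists2 Z, F Z & Y `<=` Z].

Definition eventually_le (f g : nat -> nat) : Prop :=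
  \forall n \near \oo, (f n <= g n)%N.

Definition unbounded_family : set (set (nat -> nat)) :=
  [set B | ~ exists g, forall f, B f -> eventually_le f g].

Definition dominating_family : set (set (nat -> nat)) :=
  [set D | forall f, exists2 g, D g & eventually_le f g].

Definition is_covN (R : realType) U (K : set U) := is_min_card (null_covering R) K.
Definition is_cofN (R : realType) U (K : set U) := is_min_card (null_cofinal R) K.
Definition is_bounding U (K : set U) := is_min_card unbounded_family K.
Definition is_dominating U (K : set U) := is_min_card dominating_family K.

(* Any cardinal below |K| is the cardinality of a subset of K, so it is enough
   to consider unions indexed by (and of) subsets of K. *)
Definition regular_card U (K : set U) : Prop :=
  infinite_set K /\
  forall (I : set U) (F : U -> set U), I `<=` K -> card_lt I K ->
    (forall i, I i -> F i `<=` K /\ card_lt (F i) K) ->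
    card_lt (\bigcup_(i in I) F i) K.

Definition sierpinski (R : realType) U (K : set U) (X : set cantor_space) : Prop :=
  [/\ ~ countable K, (K #<= X)%card &
      forall Y, coin_null R Y -> card_lt (X `&` Y) K].

Definition cover_class := forall X : topologicalType, set (set (set X)).

Definition open_covers : cover_class := fun X =>
  [set U | [/\ forall V, U V -> V <> setT, \bigcup_(V in U) V = setT &
               forall V, U V -> open V]].

Definition gamma_covers : cover_class := fun X =>
  [set U | [/\ open_covers U, infinite_set U &
               forall x, finite_set [set V | U V /\ ~ V x]]].

Definition S1 (A B : cover_class) (X : topologicalType) : Prop :=
  forall U : nat -> set (set X), (forall n, A X (U n)) ->
    exists2 V : nat -> set X, (forall n, U n (V n)) & B X (range V).

(* Main.v *)
Require Import Defs.
From mathcomp Require Import all_boot all_order all_algebra finmap.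
From mathcomp Require Import all_classical all_reals.
From mathcomp Require Import topology ereal normedtype sequences numfun cantor.
From mathcomp Require Import measure wochoice ring lra.

Set Implicit Arguments.
Unset Strict Implicit.
Unset Printing Implicit Defensive.

Import Order.TTheory GRing.Theory Num.Theory.
Import numFieldNormedType.Exports.

Local Open Scope classical_set_scope.
Local Open Scope card_scope.

(** Let e(a), a in K, enumerate a cofinal family of null sets in order type |K|,
   and let w(a) be arbitrary targets in the Cantor group. Since |K| is regular
   (for |K| = b because a small union of bounded families is bounded) and S is
   Sierpinski, one can choose x(a) in S such that y(a) = w(a) + x(a) avoids all
   e(b) with b < a. Then S' = {y(a)} is Sierpinski and S + S' contains all
   targets.

   Let A(p,k) be the clopen set of points whose p-th column has its first 1 in
   row k. For each p the A(p,k) are disjoint, so the sets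
   U(p,k) = {(x,y) | x + y notin A(p,k)} form a gamma-cover, and a selection
   U(p,g(p)) misses (x,y) at every p with x + y in A(p,g(p)).

   When |K| = c all points can be targets, and every selection misses a pair at
   all p. When |K| = b the target of e(a) is built from a function z(a) such
   that every g agrees infinitely often with some z(a). It comes from
   Bartoszynski's slaloms: g is coded by the null set N(g) of points lying in
   infinitely many of the clopen sets G(n,g(n)), where mu(G(n,k)) = 2^-n and the
   G(n,k) are independent for fixed n. If N(g) is included in a null set Y, take
   a closed C of positive measure disjoint from Y: by Baire category a portion
   C' of C meets only finitely many G(n,g(n)) in positive measure, and by
   independence the number of k with mu(C' & G(n,k)) = 0 is bounded in terms of
   n alone, for large n. *)

(** * Cardinality: small unions and small initial segments *)

Lemma card_le_inj T U (A : set T) (B : set U) : B !=set0 -> A #<= B ->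
  exists2 f : T -> U, (forall x, A x -> B (f x)) &
    forall x y, A x -> A y -> f x = f y -> x = y.
Proof.
elim/Ppointed: U => U in B *; first by rewrite emptyE => -[].
move=> _ /pcard_leP[f]; exists f => [x Ax|x y Ax Ay]; first exact: funS.
by apply: inj; rewrite inE.
Qed.

Lemma inj_in_card_le T U (A : set T) (B : set U) (f : T -> U) :
  (forall x, A x -> B (f x)) ->
  (forall x y, A x -> A y -> f x = f y -> x = y) -> A #<= B.
Proof.
move=> fAB finj; have fA : {in A &, injective f}.
  by move=> x y /set_mem Ax /set_mem Ay; exact: finj.
have /card_eqPle[_ /card_le_trans] := inj_card_eq fA; apply.
by apply: subset_card_le => _ [x Ax <-]; exact: fAB.
Qed.

(* The cofinality of |K| is |K|, without the restriction to subsets of K of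
   [regular_card] *)
Definition union_small U (K : set U) : Prop :=
  forall T V (I : set T) (F : T -> set V), card_lt I K ->
    (forall i, I i -> ~ (K #<= F i)) -> ~ (K #<= \bigcup_(i in I) F i).

Lemma eventually_le_trans g f h :
  eventually_le f g -> eventually_le g h -> eventually_le f h.
Proof. by apply: filterS2 => n; exact: leq_trans. Qed.

Lemma bounding_union_small U (K : set U) : is_bounding K -> union_small K.
Proof.
move=> [[B Bunb /card_eqPle[BK KB]] Kmin] T V I F /andP[_ /negP IK] FK KF.
have [[b Bb]|B0] := pselect (B !=set0); last first.
  by apply: Bunb; exists id => f Bf; exfalso; apply: B0; exists f.
have BF := card_le_trans BK KF.
have [F0|/set0P F0] := eqVneq (\bigcup_(i in I) F i) set0.
  by move: BF; rewrite F0 => /card_le0P B0; rewrite B0 in Bb.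
have [u uF uinj] := card_le_inj F0 BF.
have /choice[g gP] : forall i, exists g, I i ->
    forall f, B f -> F i (u f) -> eventually_le f g.
  move=> i; have [Ii|] := pselect (I i); last by exists id.
  have : ~ unbounded_family (B `&` [set f | F i (u f)]).
    move=> /Kmin Ki; apply: (FK i Ii); apply: (card_le_trans Ki).
    apply: (@inj_in_card_le _ _ _ _ u) => [f []//|f f' [Bf _] [Bf' _]].
    exact: uinj.
  move=> /contrapT[g gi]; exists g => _ f Bf Ff; exact: gi.
have : ~ unbounded_family (g @` I).
  by move=> /Kmin Kg; apply: IK; apply: (card_le_trans Kg); exact: card_image_le.
move=> /contrapT[h hP]; apply: Bunb; exists h => f Bf.
have [i Ii Fi] := uF f Bf; apply: (eventually_le_trans (gP i Ii f Bf Fi)).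
by apply: hP; exists i.
Qed.

(** Everything is carried into [K]: [v] embeds [I] in [K], and [u] pulls each [F i] back to a subset
    of [K]. *)
Lemma regular_union_small U (K : set U) : regular_card K -> union_small K.
Proof.
move=> [Kinf Kreg] T V I F IK FK KF; have /andP[IleK /negP KI] := IK.
have [F0|/set0P F0] := eqVneq (\bigcup_(i in I) F i) set0.
  by move: KF; rewrite F0 => /card_le0P K0; apply: Kinf; rewrite K0.
have [u uF uinj] := card_le_inj F0 KF.
have [v vK vinj] := card_le_inj (infinite_setN0 Kinf) IleK.
pose G k := [set x | K x /\ exists i, [/\ I i, v i = k & F i (u x)]].
suff /andP[_ /negP] : card_lt (\bigcup_(k in v @` I) G k) K.
  apply; apply: subset_card_le => x Kx; have [i Ii Fi] := uF x Kx.
  by exists (v i); [exists i|split=> //; exists i].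
apply: Kreg.
- by move=> _ [i Ii <-]; exact: vK.
- apply/andP; split; first exact: (card_le_trans (card_image_le _ _)).
  apply/negP => KvI; apply: KI; apply: (card_le_trans KvI); exact: card_image_le.
- move=> _ [i Ii <-]; have GK : G (v i) `<=` K by move=> x [].
  split=> //; apply/andP; split; first exact: subset_card_le.
  apply/negP => KG; apply: (FK i Ii); apply: (card_le_trans KG).
  apply: (@inj_in_card_le _ _ _ _ u).
    by move=> x [_ [j [Ij /(vinj _ _ Ij Ii) <-]]].
  by move=> x y [Kx _] [Ky _]; exact: uinj.
Qed.

(** Take a well-order. If some element of [K] has a segment of size |K|, let [a] be the least one
    and pull the order back along an injection [f] of [K] into the part of [K] below [a]. *)
Lemma exists_small_segments U (K : set U) : exists lt : U -> U -> Prop,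
  (forall x y, K x -> K y -> [\/ lt x y, x = y | lt y x]) /\
  (forall x, K x -> ~ (K #<= K `&` [set y | lt y x])).
Proof.
elim/Peq: U => U in K *.
have [le le_wo] := well_ordering_principle U.
have le_total x y : le x y || le y x.
  have [|z [[]]] := le_wo (pred2 x y); first by exists x; rewrite !inE eqxx.
  rewrite inE => /orP[] /eqP -> minz _.
    by rewrite minz// !inE eqxx orbT.
  by rewrite (minz x) ?orbT// !inE eqxx.
(* Both [x] and [y] are least in the pair they form, and a least element is unique. *)
have le_anti x y : le x y -> le y x -> x = y.
  move=> xy yx; have refl z : le z z by have := le_total z z; rewrite orbb.
  have [|z [_ zP]] := le_wo (pred2 x y); first by exists x; rewrite !inE eqxx.
  transitivity z; first (apply/esym/zP; split; first by rewrite !inE eqxx).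
    by move=> t; rewrite !inE => /orP[] /eqP ->.
  apply/zP; split; first by rewrite !inE eqxx orbT.
  by move=> t; rewrite !inE => /orP[] /eqP ->.
pose lt x y := le x y /\ x <> y.
have ltP x y : [\/ lt x y, x = y | lt y x].
  have [->|/eqP xy] := eqVneq x y; first by constructor 2.
  by have /orP[xley|ylex] := le_total x y; [constructor 1|constructor 3];
    split=> // /esym.
have [small|/existsNP[a0 /not_implyP[Ka0 /contrapT big0]]] :=
  pselect (forall x, K x -> ~ (K #<= K `&` [set y | lt y x])).
  by exists lt.
have [|a [[]]] := le_wo [pred a | `[< K a /\ K #<= K `&` [set y | lt y a] >]].
  by exists a0; rewrite inE.
rewrite inE => -[Ka big] amin _.
have /set0P[m0 m0P] : K `&` [set y | lt y a] != set0.
  apply/eqP => E; move: big; rewrite E => /card_le0P K0.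
  by rewrite K0 in Ka.
have [f fP finj] := card_le_inj (ex_intro _ m0 m0P) big.
exists (fun x y => lt (f x) (f y)); split=> [x y Kx Ky|x Kx Kbig].
  have [?|/finj|?] := ltP (f x) (f y); [by constructor 1| |by constructor 3].
  by move=> /(_ Kx Ky) ->; constructor 2.
(* [f] maps a segment of size |K| into the one below [f x], so [le a (f x)] by minimality of [a]. *)
have [Kfx [lefx fxa]] := fP x Kx; apply: fxa; apply: le_anti => //.
apply: amin; rewrite inE; split=> //.
apply: (card_le_trans Kbig); apply: (@inj_in_card_le _ _ _ _ f).
  by move=> y [Ky yx]; split=> //; have [] := fP y Ky.
by move=> y z [Ky _] [Kz _]; exact: finj.
Qed.

Lemma card_lt_finite T U (A : set T) (K : set U) :
  finite_set A -> infinite_set K -> card_lt A K.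
Proof.
move=> Afin Kinf; apply/andP; split; last first.
  by apply/negP => /card_le_finite/(_ Afin).
apply: (card_le_trans (finite_set_countable Afin)).
exact/infiniteP.
Qed.

(** * The Cantor group, null sets and independence *)

Definition xorc (z x : cantor_space) : cantor_space := fun i => z i (+) x i.

(** For fixed [n] the sets [zero_block (k * n) n] constrain disjoint blocks of coordinates; they are
    the independent sets G(n,k). *)
Definition zero_block (a n : nat) : set cantor_space :=
  [set x | forall i, (i < n)%N -> x (a + i)%N = false].

Definition cyl (s : seq bool) : set cantor_space :=
  [set x | forall i, (i < size s)%N -> x i = nth false s i].

Lemma depends_onI n A B :
  depends_on n A -> depends_on n B -> depends_on n (A `&` B).
Proof. by move=> An Bn x y xy [Ax Bx]; split; [exact: An Ax|exact: Bn Bx]. Qed.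

Lemma depends_onC n A : depends_on n A -> depends_on n (~` A).
Proof. by move=> An x y xy nAx Ay; apply/nAx/(An y) => // i /xy. Qed.

Lemma depends_on_xorc n A z : depends_on n A -> depends_on n (xorc z @^-1` A).
Proof. by move=> An x y xy; apply: An => i /xy; rewrite /xorc => ->. Qed.

Lemma depends_on_zero_block a n : depends_on (a + n) (zero_block a n).
Proof. by move=> x y xy x0 i ni; rewrite -xy ?ltn_add2l// x0. Qed.

Section coin.
Local Open Scope ring_scope.
Variable R : realType.

Definition coin : set cantor_space -> \bar R := mu_ext (@coin_content R).
Definition coin_prob (A : set cantor_space) : R := limn (word_freq R A).

Lemma coin_probE A n : depends_on n A -> coin_prob A = word_freq R A n.
Proof. by move=> An; apply: EFin_inj; rewrite -(coin_contentE R An). Qed.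

Lemma coinE A : finitary A -> coin A = (coin_prob A)%:E.
Proof. by move=> fA; apply: (measurable_mu_extE (@coin_content R)). Qed.

Lemma le_coin A B : A `<=` B -> (coin A <= coin B)%E.
Proof. by move=> AB; apply: le_mu_ext. Qed.

Lemma coin_ge0 A : (0 <= coin A)%E.
Proof. by apply: mu_ext_ge0 => X; exact: coin_content_ge0. Qed.

Lemma coinU A B : (coin (A `|` B) <= coin A + coin B)%E.
Proof. exact: (outer_measureU2 (mu_ext (@coin_content R))). Qed.

Lemma coin_bigcup (F : nat -> set cantor_space) :
  (coin (\bigcup_k F k) <= \sum_(k <oo) coin (F k))%E.
Proof.
exact: (outer_measure_sigma_subadditive (mu_ext (@coin_content R))).
Qed.

(** Covers of [Y] with total content below 1/(n+1), intersected over [n], give a measurable null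
    superset. *)
Lemma coin_nullP Y : coin_null R Y <-> coin Y = 0%E.
Proof.
split=> [[A [mA A0 YA]]|Y0].
  by apply/eqP; rewrite eq_le coin_ge0 andbT -A0 le_coin.
have /choice[F FP] : forall n : nat, exists F : nat -> set coin_type,
    @measurable_cover _ coin_type Y F /\
    (\sum_(k <oo) coin_content R (F k) < n.+1%:R^-1%:E)%E.
  move=> n; have : (coin Y < n.+1%:R^-1%:E)%E by rewrite Y0 lte_fin.
  by move=> /ereal_inf_lt[_ [F FY <-] ?]; exists F.
exists (\bigcap_n \bigcup_k F n k); split.
- apply: bigcapT_measurable => n; apply: bigcupT_measurable => k.
  by apply: sub_sigma_algebra; exact: (FP n).1.1.
- apply/eqP; rewrite eq_le coin_ge0 andbT.
  apply/lee_addgt0Pr => e e0; rewrite add0e.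
  have [n ne] : exists n : nat, n.+1%:R^-1 < e.
    have [n _ ne] := near_infty_natSinv_lt (PosNum e0).
    by exists n; exact: (ne n (leqnn n)).
  apply: (@le_trans _ _ (coin (\bigcup_k F n k))).
    by apply: le_coin; exact: bigcap_inf.
  apply: (le_trans (coin_bigcup _)).
  rewrite (@eq_eseriesr _ _ (fun k => coin_content R (F n k))); last first.
    by move=> k _; rewrite coinE//; exact: (FP n).1.1.
  by apply: (le_trans (ltW (FP n).2)); rewrite lee_fin ltW.
- by move=> y Yy n _; exact: (cover_subset (FP n).1).
Qed.

(** Translation acts on words of length [n] as an involution, so it only reindexes the sum. *)
Lemma coin_prob_xorc A z : finitary A -> coin_prob (xorc z @^-1` A) = coin_prob A.
Proof.
move=> [n An]; rewrite (coin_probE An) (coin_probE (@depends_on_xorc n A z An)).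
rewrite /word_freq; congr (_ / _).
pose f (t : n.-tuple bool) : n.-tuple bool := [tuple z i (+) tnth t i | i < n].
have fK : involutive f.
  by move=> t; apply: eq_from_tnth => i; rewrite !tnth_mktuple addKb.
rewrite [RHS](reindex f) /=; last by exists f => t _; exact: fK.
apply: eq_bigr => t _; rewrite !indicE; congr (nat_of_bool _)%:R.
have agree i : (i < n)%N -> xorc z (pad t) i = pad (f t) i.
  move=> ni; rewrite /xorc /pad /= (nth_map (Ordinal ni)) ?size_enum_ord//.
  by rewrite nth_enum_ord// (tnth_nth false)/= nth_enum_ord.
apply/idP/idP => /set_mem H; apply/mem_set; apply: An H => i ni.
  exact: agree.
by rewrite agree.
Qed.

Lemma coin_null_xorc z Y : coin_null R Y -> coin_null R (xorc z @^-1` Y).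
Proof.
move=> /coin_nullP Y0; apply/coin_nullP/eqP; rewrite eq_le coin_ge0 andbT -Y0.
apply: le_ereal_inf_tmp => _ [F [mF YF] <-].
apply: (@le_trans _ _ (coin (\bigcup_k (xorc z @^-1` (F k))))).
  by apply: le_coin => x /YF [k _ Fk]; exists k.
apply: (le_trans (coin_bigcup _)); rewrite le_eqVlt; apply/orP; left; apply/eqP.
apply: eq_eseriesr => k _; have [n Fn] := mF k.
rewrite coinE ?coin_prob_xorc//.
  exact: mF.
by exists n; exact: (@depends_on_xorc n (F k) z Fn).
Qed.

Lemma coin_null1 x : coin_null R [set x].
Proof.
apply/coin_nullP/eqP; rewrite eq_le coin_ge0 andbT.
apply/lee_addgt0Pr => e e0; rewrite add0e.
have [n _ /(_ n (leqnn n)) ne] := near_infty_natSinv_expn_lt (PosNum e0).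
apply: (@le_trans _ _ (coin (cyl (mkseq x n)))).
  by apply: le_coin => _ -> i; rewrite size_mkseq => ni; rewrite nth_mkseq.
have -> : coin (cyl (mkseq x n)) = (2 ^- size (mkseq x n))%:E.
  exact: fair_coin_cylinder.
by rewrite size_mkseq lee_fin -div1r; exact: ltW.
Qed.

Lemma coin_null_bigcup (F : nat -> set cantor_space) :
  (forall k, coin_null R (F k)) -> coin_null R (\bigcup_k F k).
Proof. exact: negligible_bigcup. Qed.

Lemma coin_nullU A B : coin_null R A -> coin_null R B -> coin_null R (A `|` B).
Proof. exact: negligibleU. Qed.

Lemma coin_nullS A B : A `<=` B -> coin_null R B -> coin_null R A.
Proof. by move=> AB; apply: (@negligibleS _ _ _ (fair_coin R)). Qed.

Lemma coin_probT : coin_prob setT = 1.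
Proof.
rewrite (@coin_probE setT 0%N)// /word_freq expr0 divr1.
under eq_bigr do rewrite indicT.
by rewrite sumr_const card_tuple expn0.
Qed.

Lemma coin_nullT : ~ coin_null R setT.
Proof.
move=> /coin_nullP; rewrite coinE; last by exists 0%N.
by rewrite coin_probT => /eqP; rewrite eqe oner_eq0.
Qed.

Lemma coin_probU n A B : depends_on n A -> depends_on n B -> A `&` B = set0 ->
  coin_prob (A `|` B) = coin_prob A + coin_prob B.
Proof.
move=> An Bn AB; apply: EFin_inj; rewrite EFinD.
by apply: (measureU (@coin_content R)) => //; exists n.
Qed.

(** Flipping coordinate [b] preserves [coin_prob] and [B], and exchanges the two halves of [B]. *)
Lemma coin_prob_half b B : depends_on b B ->
  coin_prob (B `&` [set x | x b = false]) = coin_prob B / 2.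
Proof.
move=> Bb; pose e : cantor_space := fun i => i == b.
have db c : depends_on b.+1 [set x : cantor_space | x b = c].
  by move=> x y /(_ b (leqnn _)) /= ->.
have Bb' := depends_on_le (leqnSn b) Bb.
have BE : B = (B `&` [set x | x b = false]) `|` (B `&` [set x | x b = true]).
  by rewrite -setIUr setIidl// => x _ /=; case: (x b); [right|left].
have flip : B `&` [set x | x b = true] =
    xorc e @^-1` (B `&` [set x | x b = false]).
  have same x i : (i < b)%N -> x i = xorc e x i.
    by rewrite /xorc /e; case: ltngtP.
  apply/seteqP; split=> x /= [Bx]; rewrite /xorc /e eqxx /= => xb; split.
  - by apply: Bb Bx => i ib; exact: same.
  - by rewrite xb.
  - by apply: Bb Bx => i ib; exact/esym/same.
  - by rewrite -[x b]negbK xb.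
rewrite [in RHS]BE (@coin_probU b.+1); try exact: depends_onI.
  rewrite flip coin_prob_xorc; last by exists b.+1; exact: depends_onI.
  by field.
by apply/seteqP; split=> // x [[_ /= ->]] [].
Qed.

Lemma coin_prob_zero_block a n B : depends_on a B ->
  coin_prob (B `&` zero_block a n) = coin_prob B / 2 ^+ n.
Proof.
move=> Ba; elim: n => [|n IH].
  by rewrite expr0 divr1 setIidl// => x _ i.
have -> : B `&` zero_block a n.+1 =
    (B `&` zero_block a n) `&` [set x | x (a + n)%N = false].
  apply/seteqP; split=> [x [Bx x0]|x [[Bx x0] xn]].
    split; last exact: x0.
    by split=> // i ni; apply: x0; exact: ltnW.
  by split=> // i; rewrite ltnS leq_eqVlt => /predU1P[->//|]; exact: x0.
rewrite coin_prob_half ?IH ?exprSr ?invfM ?mulrA//.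
apply: depends_onI; last exact: depends_on_zero_block.
exact: depends_on_le (leq_addr _ _) Ba.
Qed.

(** Independence, by induction on [m]: avoiding the first [m] blocks depends only on coordinates
    below [m * n], where the next block starts. *)
Lemma coin_prob_avoid (D : pred nat) n m :
  coin_prob [set x | forall k, (k < m)%N -> D k -> ~ zero_block (k * n) n x]
  = (1 - 2 ^- n) ^+ count D (iota 0 m).
Proof.
set A := fun m => [set x | forall k, (k < m)%N -> D k -> ~ zero_block (k * n) n x].
have dA j : depends_on (j * n) (A j).
  move=> x y xy Ax k kj Dk y0; apply: (Ax k kj Dk).
  apply: (@depends_on_zero_block _ _ y) y0 => i ni; rewrite xy//.
  apply: leq_trans ni _; rewrite -mulSnr leq_mul2r kj; exact: orbT.
rewrite -/(A m); elim: m => [|m IH].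
  by rewrite /A expr0 -coin_probT; congr coin_prob; apply/seteqP.
rewrite -addn1 iotaD count_cat add0n /= addn0 exprD -IH addn1.
have [Dm|Dm] := boolP (D m); last first.
  rewrite expr0 mulr1; congr coin_prob; apply/seteqP; split=> x Ax k.
    by move=> km; apply: Ax; exact: ltnW.
  by rewrite ltnS leq_eqVlt => /predU1P[->|]; [rewrite (negbTE Dm)|exact: Ax].
have dB := @depends_on_zero_block (m * n)%N n.
have dAm : depends_on (m * n + n)%N (A m).
  by apply: depends_on_le (dA m); exact: leq_addr.
have AE : A m.+1 = A m `&` ~` zero_block (m * n)%N n.
  apply/seteqP; split=> [x Ax|x [Ax x0] k].
    by split=> [k km|]; apply: Ax => //; exact: ltnW.
  by rewrite ltnS leq_eqVlt => /predU1P[->|]; [|exact: Ax].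
have : coin_prob (A m) = coin_prob (A m.+1) + coin_prob (A m) / 2 ^+ n.
  rewrite -(@coin_prob_zero_block (m * n)%N n _ (dA m)).
  rewrite -(@coin_probU (m * n + n)%N).
  - by rewrite AE -setIUr setUC setUv setIT.
  - by rewrite AE; apply: depends_onI => //; exact: depends_onC.
  - exact: depends_onI.
  - by rewrite AE; apply/seteqP; split=> // x [[_ +] [_ +]].
rewrite expr1 mulrBr mulr1; lra.
Qed.

End coin.

(** * Slaloms from null sets *)

Section slalom.
Local Open Scope ring_scope.
Variable R : realType.
Local Notation coin := (coin R).

Lemma onesub_half_itv n : 0 <= (1 - 2 ^- n : R) < 1.
Proof.
rewrite subr_ge0 invf_le1 ?exprn_gt0// exprn_ege1 ?ler1n//=.
Qed.

(** Up to a null set, [K] lies in the set avoiding the blocks listed in [s], whose measure is this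
    power by independence. *)
Lemma coin_le_expr K n (s : seq nat) : uniq s ->
  (forall k, k \in s -> coin (K `&` zero_block (k * n) n) = 0%E) ->
  (coin K <= ((1 - 2 ^- n) ^+ size s)%:E)%E.
Proof.
move=> us s0; pose m := (\max_(k <- s) k).+1.
pose A := [set x | forall k, (k < m)%N -> k \in s -> ~ zero_block (k * n) n x].
have -> : ((1 - 2 ^- n) ^+ size s)%:E = coin A.
  rewrite coinE; last first.
    exists (m * n)%N => x y xy Ax k km ks y0; apply: (Ax k km ks) => i ni.
    rewrite xy ?y0//; apply: (@leq_trans (k.+1 * n)).
      by rewrite mulSnr ltn_add2l.
    by rewrite leq_mul2r km orbT.
  rewrite (coin_prob_avoid R (mem s)) -size_filter; congr ((_ ^+ _)%:E).
  apply/esym/perm_size/uniq_perm => //; first by rewrite filter_uniq ?iota_uniq.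
  move=> k; rewrite mem_filter mem_iota add0n inE /=.
  by apply/andb_idr => ks; rewrite ltnS; exact: (@leq_bigmax_seq _ _ xpredT id k).
pose F k := if k \in s then K `&` zero_block (k * n) n else set0.
apply: (@le_trans _ _ (coin (\bigcup_k F k `|` A))).
  apply: le_coin => x Kx; have [Ax|/existsNP[k /not_implyP[km]]] := pselect (A x).
    by right.
  move=> /not_implyP[ks /contrapT x0]; left; exists k => //.
  by rewrite /F ks.
apply: (le_trans (coinU _ _ _)); rewrite -[leRHS]add0e leeD2r//.
apply: (le_trans (coin_bigcup _ _)); rewrite eseries0// => k _ _.
rewrite /F; case: ifPn => [ks|_]; first exact: s0.
by apply/coin_nullP; exact: (@negligible_set0 _ _ _ (fair_coin R)).
Qed.

(** By [coin_le_expr], more than [h] null blocks would make the measure of [K] too small. *)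
Lemma slalom_seq K n h : (((1 - 2 ^- n) ^+ h)%:E < coin K)%E ->
  exists2 L : seq nat, (size L <= h)%N &
    forall k, coin (K `&` zero_block (k * n) n) = 0%E -> k \in L.
Proof.
move=> hK; pose phi := [set k | coin (K `&` zero_block (k * n) n) = 0%E].
have Dh (D : {fset nat}) : [set` D] `<=` phi -> (#|` D| <= h)%N.
  move=> Dphi; rewrite leqNgt; apply/negP => hD.
  move: hK; rewrite ltNge => /negP; apply.
  apply: (le_trans (@coin_le_expr K n (enum_fset D) (fset_uniq D) Dphi)).
  rewrite lee_fin; have /andP[p0 p1] := onesub_half_itv n.
  by apply: ler_wiXn2l (ltnW hD) => //; exact: ltW.
have fphi : finite_set phi.
  apply: contrapT => /(infinite_set_fset h.+1)[D Dphi].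
  by rewrite leqNgt ltnS Dh.
exists (enum_fset (fset_set phi)).
  by apply: Dh; rewrite fset_setK.
by move=> k k0; rewrite -[_ \in _]/(k \in fset_set phi) in_fset_set// inE.
Qed.

Definition blocks_limsup (g : nat -> nat) : set cantor_space :=
  lim_sup_set (fun n => zero_block (g n * n) n).

Lemma coin_zero_block a n : coin (zero_block a n) = (2 ^- n)%:E.
Proof.
rewrite coinE; last by exists (a + n)%N; exact: depends_on_zero_block.
by rewrite -[zero_block _ _]setTI coin_prob_zero_block// coin_probT div1r.
Qed.

(** Borel-Cantelli: the block measures 2^-n are summable. *)
Lemma coin_null_blocks_limsup g : coin_null R (blocks_limsup g).
Proof.
apply/coin_nullP; apply: (@lim_sup_set_cvg0 _ _ _ (fair_coin R)).
  move=> k; apply: sub_sigma_algebra.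
  by exists (g k * k + k)%N; exact: depends_on_zero_block.
rewrite (@eq_eseriesr _ _ (fun k => (2 / (2 ^ (k + 1))%:R)%:E)); last first.
  move=> k _; rewrite -[LHS]/(coin _) coin_zero_block; congr EFin.
  by rewrite addn1 natrX exprS invfM mulrA divff ?mul1r// pnatr_eq0.
have /cvg_lim -> // := @cvg_geometric_eseries_half R 2 0.
by rewrite ltry.
Qed.

(** A cylinder is the union of those of its two one-letter extensions, so one of them keeps nonzero
    measure. *)
Lemma coin_pos_extend (A : set cantor_space) s l : coin (A `&` cyl s) <> 0%E ->
  exists t, [/\ prefix s t, (l <= size t)%N & coin (A `&` cyl t) <> 0%E].
Proof.
elim: l => [|l IH] spos; first by exists s; split=> //; exact: prefix_refl.
have [t [st lt tpos]] := IH spos.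
suff [b bpos] : exists b, coin (A `&` cyl (rcons t b)) <> 0%E.
  exists (rcons t b); split => //; last by rewrite size_rcons.
  exact: prefix_trans st (prefix_rcons _ _).
apply: contrapT => /forallNP nopos; apply: tpos; apply/coin_nullP.
apply: (@coin_nullS _ _ ((A `&` cyl (rcons t true)) `|` (A `&` cyl (rcons t false)))).
  move=> x [Ax tx].
  suff : cyl (rcons t (x (size t))) x by case: (x (size t)) => ?; [left|right].
  move=> i; rewrite size_rcons ltnS nth_rcons leq_eqVlt => /predU1P[->|it].
    by rewrite ltnn eqxx.
  by rewrite it tx.
by apply: coin_nullU; apply/coin_nullP; apply: contrapT; exact: nopos.
Qed.

(** A set of nonzero measure has measure above 2^-n for all large [n], so this [h], independent of
    the set, eventually meets the hypothesis of [slalom_seq]. *)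
Lemma exists_slalom_width : exists h : nat -> nat, forall n,
  (1 - 2 ^- n) ^+ h n < 2 ^- n :> R.
Proof.
suff /choice[h hP] : forall n, exists h : nat, (1 - 2 ^- n) ^+ h < 2 ^- n :> R.
  by exists h.
move=> n.
have /andP[p0 p1] := onesub_half_itv n.
have cv : (1 - 2 ^- n : R) ^+ h @[h --> \oo] --> 0.
  by apply: cvg_expr; rewrite ger0_norm.
have e0 : 0 < 2 ^- n :> R by rewrite invr_gt0 exprn_gt0.
have [h _ /(_ h (leqnn h)) /=] := cvgr_lt 0 cv _ e0.
by exists h.
Qed.

(** By subadditivity, clopen sets of total measure below 1 leave a complement of nonzero measure. *)
Lemma coin_null_cover Y : coin_null R Y ->
  exists F : nat -> set cantor_space,
  [/\ forall k, finitary (F k), Y `<=` \bigcup_k F k &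
      coin (~` \bigcup_k F k) <> 0%E].
Proof.
move=> /coin_nullP Y0; have : (coin Y < 1)%E by rewrite Y0 lte_fin.
move=> /ereal_inf_lt[_ [F [mF YF] <-] F1]; exists F; split=> //.
move=> C0; move: F1; rewrite ltNge => /negP; apply.
have -> : (1 = coin setT)%E by rewrite coinE ?coin_probT//; exists 0%N.
rewrite -(setUv (\bigcup_k F k)); apply: (le_trans (coinU _ _ _)).
rewrite C0 adde0; apply: (le_trans (coin_bigcup _ _)).
rewrite le_eqVlt; apply/orP; left; apply/eqP/eq_eseriesr => k _.
by rewrite coinE//; exact: mF.
Qed.

(* Baire category: otherwise a point of [blocks_limsup g] outside all the [F k]
   is obtained by successively extending words [s] with [coin (K `&` cyl s)]
   nonzero, where [K] is the complement of the union of the [F k]. *)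
Lemma blocks_limsup_cover (F : nat -> set cantor_space) g :
  (forall k, finitary (F k)) -> coin (~` \bigcup_k F k) <> 0%E ->
  blocks_limsup g `<=` \bigcup_k F k ->
  exists2 s, coin (~` (\bigcup_k F k) `&` cyl s) <> 0%E &
    \forall n \near \oo,
      coin (~` (\bigcup_k F k) `&` cyl s `&` zero_block (g n * n) n) = 0%E.
Proof.
set K := ~` _ => finF K0 gF; apply: contrapT => /forall2NP noword.
pose pos s := coin (K `&` cyl s) <> 0%E.
(* The new word forces membership in a block of index at least the old length, so iteration meets
   blocks of unbounded index. *)
have /choice[f fP] : forall s, exists t, pos s ->
    [/\ pos t, prefix s t, (size s < size t)%N &
      exists2 n, (size s <= n)%N & cyl t `<=` zero_block (g n * n) n].
  move=> s; have [spos|] := pselect (pos s); last by exists [::].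
  have [/(_ spos)//|nonear] := noword s.
  have [n sn npos] : exists2 n, (size s <= n)%N &
      coin (K `&` cyl s `&` zero_block (g n * n) n) <> 0%E.
    apply: contrapT => /forall2NP nopos; apply: nonear; exists (size s) => // n sn.
    by have [|/contrapT] := nopos n.
  rewrite -setIA (setIC (cyl s)) setIA in npos.
  (* This length makes [t] longer than [s] and lets it decide the whole block. *)
  have [t [st lt tpos]] := coin_pos_extend (maxn (size s).+1 (g n * n + n)) npos.
  exists t => _; split=> //.
  - move=> /coin_nullP Kt0; apply: tpos; apply/coin_nullP.
    by apply: coin_nullS Kt0 => x [[]].
  - by apply: leq_trans lt; exact: leq_maxl.
  exists n => // x tx.
  have [y [[_ yn] ty]] : K `&` zero_block (g n * n) n `&` cyl t !=set0.
    apply/set0P/eqP => E0; apply: tpos; rewrite E0; apply/coin_nullP.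
    exact: (@negligible_set0 _ _ _ (fair_coin R)).
  apply: (@depends_on_zero_block _ _ y) yn => i ni.
  have it : (i < size t)%N by apply: leq_trans ni (leq_trans (leq_maxr _ _) lt).
  by rewrite tx ?ty.
pose s j := iter j f [::].
have spos j : pos (s j).
  elim: j => [|j /fP[]//]; rewrite /pos (_ : K `&` _ = K)//.
  by apply/setIidl => x _ i.
have sS j := fP _ (spos j).
have size_s j : (j <= size (s j))%N.
  by elim: j => // j IH; have [_ _ + _] := sS j; exact: leq_ltn_trans.
(* As [s i.+1] has length above [i], the default [false] is never read. *)
pose x : cantor_space := fun i => nth false (s i.+1) i.
have sx j : cyl (s j) x.
  move=> i ij; rewrite /x.
  have pre a b : (a <= b)%N -> prefix (s a) (s b).
    move=> /subnK <-; elim: (b - a)%N => [|c IH]; first exact: prefix_refl.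
    by rewrite addSn; have [_ + _ _] := sS (c + a)%N; exact: prefix_trans.
  have nthE a b : (i < size (s a))%N -> prefix (s a) (s b) ->
      nth false (s a) i = nth false (s b) i.
    by move=> ia /prefixP[r ->]; rewrite nth_cat ia.
  have [/pre|/ltnW/pre] := leqP j i.+1; first by move=> /nthE ->.
  by move=> /nthE ->.
have [k _ Fkx] : (\bigcup_k F k) x.
  apply: gF => m _; have [_ _ _ [n mn sn]] := sS m.
  by exists n => /=; [exact: leq_trans (size_s m) mn|exact: sn (sx m.+1)].
(* [F k] is decided by the first [n] coordinates, where [x] agrees with a point of [K] in
   [cyl (s n)]; that point would lie in [F k]. *)
have [n Fn] := finF k.
have [y [Ky sy]] : K `&` cyl (s n) !=set0.
  apply/set0P/eqP => E0; apply: (spos n); rewrite E0; apply/coin_nullP.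
  exact: (@negligible_set0 _ _ _ (fair_coin R)).
apply: Ky; exists k => //; apply: Fn Fkx => i ni.
have is_ := leq_trans ni (size_s n).
by rewrite (sx n i is_) (sy i is_).
Qed.

(** There is one slalom per word, and words are countable. Once 2^-n is below the measure of the
    portion of [K] in the cylinder of [word j], [phi j n] contains every [k] whose block meets it in
    measure zero; [blocks_limsup_cover] supplies the word for [g]. *)
Lemma null_slalom : exists h : nat -> nat, forall Y, coin_null R Y ->
  exists2 phi : nat -> nat -> seq nat, (forall j n, (size (phi j n) <= h n)%N) &
    forall g, blocks_limsup g `<=` Y ->
      exists j, \forall n \near \oo, g n \in phi j n.
Proof.
have [h hP] := exists_slalom_width; exists h => Y /coin_null_cover[F [finF YF K0]].
set K := ~` _ in K0.
pose word (j : nat) : seq bool := odflt [::] (choice.unpickle j).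
have /choice[phi phiP] : forall jn : nat * nat, exists L : seq nat,
    (size L <= h jn.2)%N /\
    ((2 ^- jn.2)%:E < coin (K `&` cyl (word jn.1)) ->
     forall k, coin (K `&` cyl (word jn.1) `&` zero_block (k * jn.2) jn.2) = 0%E ->
       k \in L)%E.
  move=> [j n] /=; have [big|] := pselect (((2 ^- n)%:E < coin (K `&` cyl (word j)))%E).
    have := lt_trans _ big; move=> /(_ ((1 - 2 ^- n) ^+ h n)%:E); rewrite lte_fin.
    by move=> /(_ (hP n))/slalom_seq[L Lh LP]; exists L.
  by exists [::].
exists (fun j n => phi (j, n)) => [j n|g gY]; first exact: (phiP (j, n)).1.
have [s s0 sg] := blocks_limsup_cover finF K0 (subset_trans gY YF).
have s_gt : \forall n \near \oo, ((2 ^- n)%:E < coin (K `&` cyl s))%E.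
  have : (0 < coin (K `&` cyl s))%E by rewrite lt_def coin_ge0 andbT; apply/eqP.
  case: (coin _) => [r|_|//]; last by apply: nearW => n; rewrite ltry.
  rewrite lte_fin => r0; apply: filterS (near_infty_natSinv_expn_lt (PosNum r0)).
  by move=> n; rewrite lte_fin div1r.
exists (choice.pickle s); near=> n; apply: (phiP (choice.pickle s, n)).2 => /=;
  last first.
  by rewrite /word choice.pickleK; near: n.
by rewrite /word choice.pickleK; near: n.
Unshelve. all: by end_near. Qed.

(* [code g n] codes all the values of [g] that a slalom of width [h n] can be
   made to guess, so that guessing [code g] yields a function equal to [g]
   infinitely often. *)
Lemma null_infinitely_equal : exists code : (nat -> nat) -> nat -> nat,
  forall Y, coin_null R Y -> exists z : nat -> nat, forall g,
    blocks_limsup (code g) `<=` Y -> infinite_set [set m | z m = g m].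
Proof.
have [h hP] := null_slalom.
(* At [idx n j i] the guess is that [code g n] is entry [i] of [phi j n]. *)
pose idx (n j i : nat) : nat := choice.pickle (n, j, i).
(* Rows up to [n] are stored, so any fixed [j] is covered from level [j] on. *)
pose code (g : nat -> nat) n : nat :=
  choice.pickle (mkseq (fun j => mkseq (fun i => g (idx n j i)) (h n)) n.+1).
exists code => Y /hP[phi phih phiP].
pose decode (m : nat) : seq (seq nat) := odflt [::] (choice.unpickle m).
pose guess n j i := nth 0%N (nth [::] (decode (nth 0%N (phi j n) i)) j) i.
exists (fun m => if choice.unpickle m is Some (n, j, i) then guess n j i else 0%N).
move=> g /phiP[j [N _ NP]] fin.
pose level (m : nat) : nat :=
  if (choice.unpickle m : option (nat * nat * nat)) is Some (n, _, _) then n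
  else 0%N.
(* Each large level [n] has an agreement, at the position of [code g n] in [phi j n]. *)
have : [set n | (maxn N j <= n)%N] `<=` level @` [set m |
    (if choice.unpickle m is Some (n, j, i) then guess n j i else 0%N) = g m].
  move=> n /=; rewrite geq_max => /andP[Nn jn].
  pose i := index (code g n) (phi j n).
  have gphi : code g n \in phi j n by exact: NP.
  have ih : (i < h n)%N by apply: leq_trans (phih j n); rewrite index_mem.
  exists (idx n j i); last by rewrite /level choice.pickleK.
  rewrite /= choice.pickleK /guess nth_index// /decode choice.pickleK /=.
  by rewrite !nth_mkseq.
move=> /sub_finite_set/(_ (finite_image _ fin)) fin_ge; apply: infinite_nat.
apply: (@sub_finite_set _ _ (`I_(maxn N j) `|` [set n | (maxn N j <= n)%N])).
  by move=> n _; have [|] := ltnP n (maxn N j); [left|right].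
by rewrite finite_setU; split.
Qed.

End slalom.

(** * A second Sierpinski set reaching prescribed targets *)

Section sierpinski_translates.
Variables (R : realType) (U : Type) (K : set U) (S : set cantor_space).
Variables (e : U -> set cantor_space) (w : U -> cantor_space).
Hypotheses (Ksmall : union_small K) (SK : sierpinski R K S).
Hypotheses (e_null : forall a, K a -> coin_null R (e a)).
Hypothesis e_cofinal : forall Y, coin_null R Y -> exists2 a, K a & Y `<=` e a.

Lemma sierpinski_translates : exists2 S', sierpinski R K S' &
  forall a, K a -> exists x y, [/\ S x, S' y & w a = xorc x y].
Proof.
have [Kunc KS Snull] := SK.
have Kinf : infinite_set K by move=> /finite_set_countable.
have [lt [ltP seg]] := exists_small_segments K.
have seg1 a : K a -> ~ (K #<= (K `&` [set b | lt b a]) `|` [set a]).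
  move=> Ka Kle; apply: (@Ksmall bool U setT
    (fun c => if c then K `&` [set b | lt b a] else [set a])).
  - exact: card_lt_finite.
  - move=> [] _; first exact: seg.
    by have /andP[_ /negP] := card_lt_finite (finite_set1 a) Kinf.
  - apply: (card_le_trans Kle); apply: subset_card_le => b [Kb|ba].
      by exists true.
    by exists false.
(* Fewer than |K| translated null sets, each meeting [S] in a small set, cannot cover [S]. *)
have /choice[x xP] : forall a, exists x, K a ->
    S x /\ forall b, K b -> lt b a -> ~ e b (xorc (w a) x).
  move=> a; have [Ka|] := pselect (K a); last by exists (w a).
  apply: contrapT => /forallNP nox.
  apply: (@Ksmall U cantor_space (K `&` [set b | lt b a])
    (fun b => S `&` xorc (w a) @^-1` e b)).
  - apply/andP; split; first by apply: subset_card_le => ? [].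
    by apply/negP; exact: seg.
  - move=> b [Kb _]; have /andP[_ /negP] // := Snull _ (coin_null_xorc (w a) (e_null Kb)).
  - apply: (card_le_trans KS); apply: subset_card_le => x Sx.
    apply: contrapT => nocov; apply: (nox x) => _; split=> // b Kb ba eb.
    by apply: nocov; exists b.
pose y a := xorc (w a) (x a).
have y_null b Y : K b -> Y `<=` e b ->
    K `&` [set a | Y (y a)] `<=` (K `&` [set a | lt a b]) `|` [set b].
  move=> Kb Yb a [Ka /Yb eb].
  have [ba|->|ab] := ltP b a Kb Ka; [|by right|by left].
  by have [_ /(_ b Kb ba)] := xP a Ka.
exists (y @` K); last first.
  move=> a Ka; exists (x a), (y a); split; first by have [] := xP a Ka.
    by exists a.
  by apply/funext => i; rewrite /y /xorc addbCA addbb addbF.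
split=> //.
(* Singletons are null, so the fibres of [y] are small; a small image would make [K] a small union
   of small fibres. *)
- apply: contrapT => KS'.
  apply: (@Ksmall _ _ (y @` K) (fun v => K `&` [set a | y a = v])).
  + by apply/andP; split; [exact: card_image_le|exact/negP].
  + move=> v _ Kv; have [b Kb vb] := e_cofinal (coin_null1 R v).
    apply: (seg1 b Kb); apply: (card_le_trans Kv); apply: subset_card_le.
    exact: y_null vb.
  + by apply: subset_card_le => a Ka; exists (y a) => //; exists a.
- move=> Y /e_cofinal[b Kb Yb].
  have yY : y @` K `&` Y `<=` y @` ((K `&` [set a | lt a b]) `|` [set b]).
    by move=> _ [[a Ka <-] Ya]; exists a => //; apply: (y_null b Y Kb Yb).
  have leY := card_le_trans (subset_card_le yY) (card_image_le _ _).
  apply/andP; split.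
    by apply: (card_le_trans leY); apply: subset_card_le => a [[]|->].
  by apply/negP => /card_le_trans/(_ leY); exact: seg1.
Qed.

End sierpinski_translates.

(** * Gamma-covers of the product *)

Definition bit (p k : nat) : nat := choice.pickle (p, k).

Definition first_one (p k : nat) : set cantor_space :=
  [set x : cantor_space | x (bit p k) /\ forall j, (j < k)%N -> ~~ x (bit p j)].

(** Point masses as sums witness that the sets [miss_first_one p k] are proper and pairwise
    distinct. *)
Definition point_mass (i : nat) : cantor_space := fun j => j == i.

Definition graph_bits (z : nat -> nat) : cantor_space :=
  fun i => if choice.unpickle i is Some (p, k) then k == z p else false.

Lemma first_one_finitary p k : finitary (first_one p k).
Proof.
exists (\max_(j < k.+1) bit p j).+1 => x y xy [xk xj].
have agree j : (j <= k)%N -> x (bit p j) = y (bit p j).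
  rewrite -ltnS => jk; apply: xy; rewrite ltnS.
  exact: (leq_bigmax (Ordinal jk)).
split; first by rewrite -agree.
by move=> j jk; rewrite -agree ?xj// ltnW.
Qed.

Lemma first_one_inj p k l x : first_one p k x -> first_one p l x -> k = l.
Proof.
move=> [xk kmin] [xl lmin]; have [lk|kl|//] := ltngtP l k.
  by move: (kmin _ lk); rewrite xl.
by move: (lmin _ kl); rewrite xk.
Qed.

Lemma first_one_point_mass p k q l :
  first_one q l (point_mass (bit p k)) <-> (q, l) = (p, k).
Proof.
split=> [[/eqP /(pcan_inj choice.pickleK)]//|[-> ->]].
split=> [|j jk]; first exact: eqxx.
by apply/eqP => /(pcan_inj choice.pickleK)[jk']; rewrite jk' ltnn in jk.
Qed.

Lemma first_one_graph_bits z p : first_one p (z p) (graph_bits z).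
Proof.
rewrite /first_one /graph_bits /bit /=; split; first by rewrite choice.pickleK.
by move=> j jz; rewrite choice.pickleK; case: ltngtP jz.
Qed.

Section product_covers.
Variables S S' : set cantor_space.
Local Notation W := (set_type S * set_type S')%type.

Definition pair_sum (v : W) : cantor_space := xorc (set_val v.1) (set_val v.2).

Definition miss_first_one (p k : nat) : set W :=
  [set v | ~ first_one p k (pair_sum v)].

Lemma pair_sum_surj x y : S x -> S' y -> exists v, pair_sum v = xorc x y.
Proof.
by move=> Sx Sy; exists (SigSub (mem_set Sx), SigSub (mem_set Sy)).
Qed.

Lemma finitary_pair_sum_open A : finitary A -> open [set v | A (pair_sum v)].
Proof.
move=> [n An]; rewrite openE => -[x y] /= Axy; rewrite /interior.
pose C z := [set t : cantor_space | forall i, (i < n)%N -> t i = z i].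
have C_open z : open (C z).
  by apply: finitary_open; exists n => s t st Cs i ni; rewrite -st ?Cs.
have near_val (T : set cantor_space) (z : set_type T) :
    nbhs z (set_val @^-1` C (set_val z)).
  have := @initial_continuous (set_type T) cantor_space set_val z.
  by apply; apply: open_nbhs_nbhs; split.
exists (set_val @^-1` C (set_val x), set_val @^-1` C (set_val y)).
  by split; exact: near_val.
move=> [s t] /= [Cs Ct]; apply: An Axy => i ni.
by rewrite /pair_sum /xorc /= Cs ?Ct.
Qed.

Hypothesis point_mass_sum : forall i, exists v, pair_sum v = point_mass i.

Lemma miss_first_one_inj p k q l :
  miss_first_one p k = miss_first_one q l -> (p, k) = (q, l).
Proof.
move=> E; have [v vE] := point_mass_sum (bit q l).
have : ~ miss_first_one p k v.
  by rewrite E; apply; rewrite vE; exact/first_one_point_mass.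
by move=> /contrapT; rewrite vE => /first_one_point_mass.
Qed.

(** For fixed [p] the sets [first_one p k] are disjoint: a pair is omitted by at most one member,
    and two members already cover. *)
Lemma gamma_miss_first_one p : gamma_covers (range (miss_first_one p)).
Proof.
split.
- split.
  + move=> _ [k _ <-] E; have [v vE] := point_mass_sum (bit p k).
    have : miss_first_one p k v by rewrite E.
    by apply; rewrite vE; exact/first_one_point_mass.
  + apply/seteqP; split=> // v _.
    have [v0|v0] := pselect (first_one p 0 (pair_sum v)); last first.
      by exists (miss_first_one p 0) => //; exists 0.
    exists (miss_first_one p 1); first by exists 1.
    by move=> v1; have := first_one_inj v0 v1.
  + move=> _ [k _ <-]; apply: (@finitary_pair_sum_open (~` first_one p k)).
    exact/finitaryC/first_one_finitary.
- move=> fin; apply: infinite_nat.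
  apply: (@sub_finite_set _ _ (miss_first_one p @^-1` range (miss_first_one p))).
    by move=> k _; exists k.
  by apply: finite_preimage fin => k l _ _ /miss_first_one_inj[].
- move=> v; have [[k vk]|novk] := pselect (exists k, first_one p k (pair_sum v)).
    apply: (@sub_finite_set _ _ [set miss_first_one p k]) => // _ [[l _ <-]].
    by move=> /contrapT vl; rewrite (first_one_inj vk vl).
  apply: (@sub_finite_set _ _ set0) => // _ [[l _ <-] /contrapT vl].
  by apply: novk; exists l.
Qed.

(** A selection has the form [miss_first_one p (g p)]; a pair with sum [graph_bits g] lies in none
    of these. *)
Lemma not_S1_gamma_open : (forall x, exists v, pair_sum v = x) ->
  ~ S1 gamma_covers open_covers W.
Proof.
move=> all_sums /(_ _ gamma_miss_first_one)[V VU [_ Vcov _]].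
have /choice[g gP] : forall p, exists k, miss_first_one p k = V p.
  by move=> p; have [k _ kV] := VU p; exists k.
have [v vE] := all_sums (graph_bits g).
have [_ [p _ <-]] : (\bigcup_(A in range V) A) v by rewrite Vcov.
by rewrite -gP; apply; rewrite vE; exact: first_one_graph_bits.
Qed.

(** A gamma-cover counts members, not indices: by [miss_first_one_inj], misses at infinitely many
    [p] are misses of infinitely many members. *)
Lemma not_S1_gamma_gamma :
  (forall g : nat -> nat, exists v,
    infinite_set [set p | first_one p (g p) (pair_sum v)]) ->
  ~ S1 gamma_covers gamma_covers W.
Proof.
move=> inf_hits /(_ _ gamma_miss_first_one)[V VU [_ _ Vfin]].
have /choice[g gP] : forall p, exists k, miss_first_one p k = V p.
  by move=> p; have [k _ kV] := VU p; exists k.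
have [v] := inf_hits g; apply.
apply: (@sub_finite_set _ _ (V @^-1` [set A | range V A /\ ~ A v])).
  by move=> p vp; split; [exists p|rewrite -gP; exact].
by apply: finite_preimage (Vfin v) => p q _ _; rewrite -!gP => /miss_first_one_inj[].
Qed.

End product_covers.

(** * Choice of the targets in the two cases *)

Lemma cofN_enum (R : realType) U (K : set U) : is_cofN R K ->
  exists2 e : U -> set cantor_space, (forall a, K a -> coin_null R (e a)) &
    forall Y, coin_null R Y -> exists2 a, K a & Y `<=` e a.
Proof.
move=> [[F [Fnull Fcof] /card_esym/card_set_bijP[e [eF _ Fe]]] _].
exists e => [a Ka|Y /Fcof[Z /Fe[a Ka <-]]]; first exact/Fnull/eF.
by exists a.
Qed.

Theorem theorem4p1 (R : realType) :
  (forall (T : Type) (b : set T),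
     is_covN R b -> is_cofN R b -> is_bounding b ->
     forall S : set cantor_space, sierpinski R b S ->
     exists2 S' : set cantor_space, sierpinski R b S' &
       ~ S1 gamma_covers gamma_covers (set_type S * set_type S')%type) /\
  (let c := [set: cantor_space] in
     is_covN R c -> is_cofN R c -> is_dominating c -> regular_card c ->
     forall S : set cantor_space, sierpinski R c S ->
     exists2 S' : set cantor_space, sierpinski R c S' &
       ~ S1 gamma_covers open_covers (set_type S * set_type S')%type).
Proof.
split.
- move=> T b _ /cofN_enum[e e_null e_cof] /bounding_union_small bsmall S Sb.
  have [bunc _ _] := Sb.
  have b0 : b !=set0.
    by apply: infinite_setN0 => /finite_set_countable.
  have /infiniteP/(card_le_inj b0)[k kb kinj] : infinite_set b.
    by move=> /finite_set_countable.
  have [code codeP] := null_infinitely_equal R.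
  have /choice[z zP] : forall a, exists z : nat -> nat, b a -> forall g,
      blocks_limsup (code g) `<=` e a -> infinite_set [set m | z m = g m].
    move=> a; have [/e_null/codeP[z za]|] := pselect (b a); last by exists id.
    by exists z.
  (* Countably many indices [k i] are reserved for the point masses that the covers require. *)
  have /choice[w wP] : forall a, exists x, (forall i, k i = a -> x = point_mass i) /\
      ((forall i, k i <> a) -> x = graph_bits (z a)).
    move=> a; have [[i <-]|noi] := pselect (exists i, k i = a).
      exists (point_mass i).
      by split=> [j kji|/(_ i)//]; rewrite (kinj j i I I kji).
    by exists (graph_bits (z a)); split=> // i ia; exfalso; apply: noi; exists i.
  have [S' S'b sums] := sierpinski_translates w bsmall Sb e_null e_cof.
  have w_sum a : b a -> exists v : set_type S * set_type S', pair_sum v = w a.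
    by move=> /sums[s [t [Ss S't ->]]]; exact: pair_sum_surj.
  exists S' => //; apply: not_S1_gamma_gamma => [i|g].
    have [v vE] := w_sum (k i) (kb i I).
    by exists v; rewrite vE; exact: (wP (k i)).1.
  have ek_null : coin_null R (\bigcup_i e (k i)).
    by apply: coin_null_bigcup => i; apply: e_null; exact: kb.
  have [x ekx] : exists x, ~ (\bigcup_i e (k i)) x.
    apply: contrapT => /forallNP all_ek; apply: (@coin_nullT R).
    by apply: coin_nullS ek_null => x _; exact: contrapT.
  (* As it contains x, e a is none of the e (k i): its target is graph_bits (z a). *)
  have [a ba gxa] :=
    e_cof _ (coin_nullU (coin_null_blocks_limsup R (code g)) (coin_null1 R x)).
  have [v vE] := w_sum a ba; exists v; rewrite vE (wP a).2; last first.
    by move=> i ia; apply: ekx; exists i => //; rewrite ia; apply: gxa; right.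
  have ga : blocks_limsup (code g) `<=` e a by move=> y gy; apply: gxa; left.
  move=> fin; apply: (zP a ba g ga); apply: sub_finite_set fin => m /= <-.
  exact: first_one_graph_bits.
- move=> c _ /cofN_enum[e e_null e_cof] _ /regular_union_small csmall S Sc.
  (* The index set is the Cantor space itself, so [id] makes every point a target. *)
  have [S' S'c sums] := sierpinski_translates id csmall Sc e_null e_cof.
  have all_sums x : exists v : set_type S * set_type S', pair_sum v = x.
    by have [s [t [Ss S't ->]]] := sums x I; exact: pair_sum_surj.
  by exists S' => //; apply: not_S1_gamma_open.
Qed.
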